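(* Let $X$ be a complex topological vector space with $\dim(X)>1$. Assume that $X$ has no isolated point and let $\Gamma\subset\mathcal{B}(X)$ be such that for all $T,S\in\Gamma$ with $T\neq S$ there exists $A\in\Gamma$ such that $T=AS$. If $\Gamma$ is hypercyclic, then $\Gamma$ is topologically transitive.
   Context: $\mathcal{B}(X)$ denotes the set of all continuous linear operators on $X$. A set $\Gamma\subset\mathcal{B}(X)$ is hypercyclic if there exists $x\in X$ such that $Orb(\Gamma,x)=\{Tx : T\in\Gamma\}$ is dense in $X$. $\Gamma$ is topologically transitive if for each pair $(U,V)$ of nonempty open subsets of $X$ there exists $T\in\Gamma$ such that $T(U)\cap V\neq\emptyset$. *)

(* Defs.v *)
From mathcomp Require Import all_boot all_order all_algebra.
From mathcomp Require Import classical_sets reals topology tvs.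
From mathcomp Require Import complex.

Set Implicit Arguments.
Unset Strict Implicit.
Unset Printing Implicit Defensive.

Local Open Scope classical_set_scope.
Local Open Scope ring_scope.

(* [dim(X) > n], for a space X that may be infinite-dimensional: some
   n + 1 vectors of X are linearly independent. *)
Definition dim_gt (K : numFieldType) (X : lmodType K) (n : nat) : Prop :=
  exists v : 'I_n.+1 -> X, forall c : 'I_n.+1 -> K,
    \sum_i c i *: v i = 0 -> forall i, c i = 0.

Definition continuous_operators (K : numFieldType) (X : topologicalLmodType K)
  : set {linear X -> X} := [set T : {linear X -> X} | continuous T].
Arguments continuous_operators {K} X.

Definition Orb (K : numFieldType) (X : topologicalLmodType K)
  (Gamma : set {linear X -> X}) (x : X) : set X := [set T x | T in Gamma].

Definition hypercyclic (K : numFieldType) (X : topologicalLmodType K)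
  (Gamma : set {linear X -> X}) : Prop := exists x : X, dense (Orb Gamma x).

Definition topologically_transitive (K : numFieldType)
  (X : topologicalLmodType K) (Gamma : set {linear X -> X}) : Prop :=
  forall U V : set X, open U -> U !=set0 -> open V -> V !=set0 ->
    exists2 T : {linear X -> X}, Gamma T & (T @` U) `&` V !=set0.

(* Main.v *)
Require Import Defs.
From mathcomp Require Import all_boot all_order all_algebra.
From mathcomp Require Import classical_sets reals topology tvs.
From mathcomp Require Import complex.

Import GRing.Theory.

(** Let [x] have a dense orbit, and let [S] in [Gamma] send [x] into [U]. If
    some [T] in [Gamma] other than [S] sends [x] into [V], then [T = A \o S]
    for some [A] in [Gamma], and [A] sends the point [S x] of [U] into [V].

    In a Hausdorff space without isolated points, [V] minus the point [S x] is
    open and nonempty, so density provides such a [T]. A topological vector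
    space need not be Hausdorff here, so [V] minus the closure of [S x] is used
    instead. It is open, and every [T] sending [x] into it differs from [S].
    It can be empty, but only when [V] is the whole space
    ([open_sub_closure1_setT]): a nonempty open set inside the closure of one
    point forces the topology to be indiscrete. Then [S] itself sends
    [U] into [V]. *)

Set Implicit Arguments.
Unset Strict Implicit.
Unset Printing Implicit Defensive.

Local Open Scope classical_set_scope.
Local Open Scope ring_scope.

Section TopologicalLmodule.
Variables (K : numFieldType) (X : topologicalLmodType K).

Lemma continuous_scale_add (b : X) :
  continuous (fun u : K^o * X => u.1 *: u.2 + b).
Proof.
move=> u; apply: (@continuous_comp (K^o * X)%type (X * X)%type X
  (fun u => (u.1 *: u.2, b)) (fun v => v.1 + v.2)); last exact: add_continuous.
by apply: cvg_pair; [exact: scale_continuous|exact: cvg_cst].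
Qed.

Lemma continuous_scale_addr (t : K) (b : X) :
  continuous (fun z : X => t *: z + b).
Proof.
move=> z; apply: (@continuous_comp X (K^o * X)%type X
  (fun z => (t, z)) (fun u => u.1 *: u.2 + b)).
  by apply: (@cvg_pair _ _ _ _ (nbhs (t : K^o))); [exact: cvg_cst|exact: cvg_id].
exact: continuous_scale_add.
Qed.

Lemma continuous_scale_addl (w b : X) :
  continuous (fun t : K^o => t *: w + b).
Proof.
move=> t; apply: (@cvg_comp K^o (K^o * X)%type X (fun t => (t, w))
  (fun u => u.1 *: u.2 + b) _ _ _ _ (@continuous_scale_add b (t : K^o, w))).
have tF := @nbhs_filter K^o t.
apply: (@cvg_pair _ _ _ _ _ _ tF tF (nbhs_filter w) id (fun=> w)).
  exact: cvg_id.
exact: cvg_cst.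
Qed.

(** Neighborhoods absorb in every direction: the scalars [t] with
    [p + t *: w] in [V] form a neighborhood of [0], and [0] is not isolated
    in [K]. *)
Lemma nbhs_absorbing (p w : X) (V : set X) : nbhs p V ->
  exists2 t : K, t != 0 & V (t *: w + p).
Proof.
move=> Vp.
have Vt : (0 : K^o)^' [set t | V (t *: w + p)].
  apply: nbhs_dnbhs; apply: (@continuous_scale_addl w p).
  by rewrite scale0r add0r.
have [t [Vtt t0]] :=
  filter_ex (filterI Vt (nbhs_dnbhs_neq (0 : K^o))).
by exists t.
Qed.

(** For [v] in [V] and any [q], a point [p + t *: (v - q)] with [t != 0] lies
    in [V], hence in the closure of [p]. The affine homeomorphism
    [z |-> q + t^-1 *: (z - p)] sends [p] to [q] and that point to [v], so [v]
    is in the closure of [q]; as [V] is a neighborhood of [v], it contains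
    [q]. *)
Lemma open_sub_closure1_setT (V : set X) (p : X) :
  open V -> V !=set0 -> V `<=` closure [set p] -> V = setT.
Proof.
move=> oV [v Vv] Vp; apply/seteqP; split=> // q _.
have VpT : V p.
  by have [_ [->]] := Vp v Vv V (open_nbhs_nbhs (conj oV Vv)).
have [t t0 Vt] := nbhs_absorbing (v - q) (open_nbhs_nbhs (conj oV VpT)).
pose h (z : X) := t^-1 *: z + (q - t^-1 *: p).
have hp : h p = q by rewrite /h addrC subrK.
have hv : h (t *: (v - q) + p) = v.
  by rewrite /h scalerDr scalerA mulVf// scale1r -addrA (addrC (_ *: p)) !subrK.
have nV : nbhs (t *: (v - q) + p) (h @^-1` V).
  by apply: continuous_scale_addr; rewrite -/(h _) hv; exact: open_nbhs_nbhs.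
by have [_ [->]] := Vp _ Vt _ nV; rewrite /= hp.
Qed.

End TopologicalLmodule.

Theorem theorem3p7 (R : realType) (X : topologicalLmodType R[i])
  (dimX : dim_gt X 1)
  (noisolX : forall x : X, ~ isolated [set: X] x)
  (Gamma : set {linear X -> X})
  (GammaB : Gamma `<=` continuous_operators X)
  (GammaT : forall T S : {linear X -> X}, Gamma T -> Gamma S -> T <> S ->
    exists2 A : {linear X -> X}, Gamma A & (T : X -> X) = A \o S) :
  hypercyclic Gamma -> topologically_transitive Gamma.
Proof.
move=> [x dx] U V oU U0 oV V0.
have [y [USx [S GS Sxy]]] := dx U U0 oU; subst y.
pose W := V `&` ~` closure [set S x].
have [W0|/set0P W0] := eqVneq W set0.
- have VT : V = setT.
    by apply: (@open_sub_closure1_setT _ _ _ (S x)) => //; apply/subsets_disjoint.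
  by exists S => //; exists (S (S x)); split; [exists (S x)|rewrite VT].
- have oW : open W.
    by apply: openI => //; apply: closed_openC; exact: closed_closure.
  have [y [[VTx ncl] [T GT Txy]]] := dx W W0 oW; subst y.
  have TS : T <> S.
    by move=> TS; apply: ncl; rewrite TS; exact: subset_closure.
  have [A GA TAS] := GammaT T S GT GS TS.
  exists A => //; exists (T x); split=> //.
  by exists (S x) => //; rewrite TAS.
Qed.
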